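(* Assume that $q > 2$. Then there exist infinitely many monic primes $\wp$ in $\mathbb{F}_q[T]$ such that the polynomial $C_{\wp}(1) \in \mathbb{F}_q[T]$ is composite (i.e., neither a unit nor a prime).
   Context: $q$ is a power of a prime, $A = \mathbb{F}_q[T]$. The Carlitz module is the unique $\mathbb{F}_q$-algebra homomorphism $a \mapsto C_a$ from $A$ to the ring of $\mathbb{F}_q$-linear polynomials in $A[x]$ (with composition as multiplication) such that $C_T(x) = Tx + x^q$; $C_a(1)$ denotes the value of the polynomial $C_a(x)$ at $x = 1$. For a monic prime $P$ and $\alpha \in \mathbb{F}_q^\times$, $\alpha C_P(1)$ is called a Mersenne number. *)

(* Defs.v *)
From HB Require Import structures.
From mathcomp Require Import all_boot all_order all_algebra all_field.
From mathcomp Require Import boolp classical_sets functions cardinality.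

Set Implicit Arguments.
Unset Strict Implicit.
Unset Printing Implicit Defensive.

Import GRing.Theory.
Local Open Scope ring_scope.

(* A finite field F stands for F_q, q = #|F|; then A = F_q[T] is {poly F}
   (its 'X is T) and A[x] is {poly {poly F}} (its 'X is x).  In 'X *: 'X the
   scalar is T and the vector is x: this is the polynomial T x of A[x]. *)
Section Carlitz.
Variable F : finFieldType.
Local Notation A := {poly F}.

Definition carlitzT : {poly A} := 'X *: 'X + 'X^#|F|.

(* C_a for a = sum_i a_i T^i is sum_i a_i C_(T^i), where C_(T^i) is the i-th
   iterate of C_T under composition. *)
Definition carlitz (a : A) : {poly A} :=
  \sum_(i < size a) (a`_i)%:P *: iter i (fun f => carlitzT \Po f) 'X.

Definition Fq_linear (f : {poly A}) : Prop :=
  forall i, f`_i != 0 -> exists k, i = (#|F| ^ k)%N.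

Definition is_carlitz_module (C : A -> {poly A}) : Prop :=
  [/\ forall a, Fq_linear (C a),
      forall (c : F) (a b : A), C (c *: a + b) = c%:P *: C a + C b,
      C 1 = 'X,
      forall a b : A, C (a * b) = C a \Po C b
    & C 'X = 'X *: 'X + 'X^#|F|].

Let tau (f : {poly A}) : {poly A} := 'X *: f + f ^+ #|F|.

Let carlitzT_comp f : carlitzT \Po f = tau f.
Proof. by rewrite /carlitzT comp_polyD comp_polyZ comp_polyX comp_Xn_poly. Qed.

Let frobD (R : comNzRingType) (f g : R) : [pchar R] =i [pchar F] ->
  (f + g) ^+ #|F| = f ^+ #|F| + g ^+ #|F|.
Proof.
have [p pr_p pF] := finPcharP F => eR.
have [n ->] : exists n, #|F| = (p ^ n)%N.
  by eexists; exact: (card_pprimeChar pF).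
apply: exprDn_pchar; rewrite pnatX; apply/orP; left.
by rewrite pnatE // eR.
Qed.

Let frobA (f g : {poly A}) : (f + g) ^+ #|F| = f ^+ #|F| + g ^+ #|F|.
Proof. by apply: frobD => p; rewrite !pchar_poly. Qed.

Let q_gt0 : (0 < #|F|)%N.
Proof. by apply/card_gt0P; exists 0. Qed.

Let tauD f g : tau (f + g) = tau f + tau g.
Proof. by rewrite /tau frobA scalerDr addrACA. Qed.

Let tauZ (c : F) f : tau (c%:P *: f) = c%:P *: tau f.
Proof.
by rewrite /tau exprZn -polyC_exp expf_card scalerDr !scalerA mulrC.
Qed.

Let tau0 : tau 0 = 0.
Proof. by rewrite /tau scaler0 expr0n gtn_eqF // addr0. Qed.

Let act n (a : A) (f : {poly A}) : {poly A} :=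
  \sum_(i < n) (a`_i)%:P *: iter i tau f.

Let act_widen n (a : A) f : (size a <= n)%N -> act n a f = act (size a) a f.
Proof.
pose G i := (a`_i)%:P *: iter i tau f.
move=> le; rewrite /act [RHS](big_ord_widen n G) // [RHS]big_mkcond /=.
apply: eq_bigr => i _; case: ltnP => // le'.
by rewrite nth_default // scale0r.
Qed.

Let iterE i f : iter i (fun g => carlitzT \Po g) f = iter i tau f.
Proof. by elim: i => //= i ->; rewrite carlitzT_comp. Qed.

Let carlitzE n (a : A) : (size a <= n)%N -> carlitz a = act n a 'X.
Proof.
move=> le; rewrite act_widen //.
by apply: eq_bigr => i _; rewrite iterE.
Qed.

Let actl n (c : F) a b f : act n (c *: a + b) f = c%:P *: act n a f + act n b f.
Proof.
rewrite /act scaler_sumr -big_split; apply: eq_bigr => i _ /=.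
by rewrite coefD coefZ polyCD polyCM scalerDl scalerA.
Qed.

Lemma carlitz_linear (c : F) (a b : A) :
  carlitz (c *: a + b) = c%:P *: carlitz a + carlitz b.
Proof.
pose n := maxn (size (c *: a + b)) (maxn (size a) (size b)).
rewrite !(@carlitzE n) ?actl //; rewrite /n !leq_max leqnn ?orbT //.
Qed.

Let carlitz0 : carlitz 0 = 0.
Proof. by rewrite /carlitz size_poly0 big_ord0. Qed.

Lemma carlitz1 : carlitz 1 = 'X.
Proof. by rewrite /carlitz size_poly1 big_ord1 /= coef1 scale1r. Qed.

Lemma carlitzX : carlitz 'X = 'X *: 'X + 'X^#|F|.
Proof.
rewrite /carlitz size_polyX big_ord_recl big_ord1 /= !coefX /= scale0r add0r.
by rewrite scale1r carlitzT_comp.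
Qed.

Let carlitz_mulX a : carlitz (a * 'X) = tau (carlitz a).
Proof.
rewrite (@carlitzE (size a).+1); last first.
  by case: (eqVneq a 0) => [->|a0]; rewrite ?mul0r ?size_poly0 ?size_mulX.
rewrite (@carlitzE (size a)) // /act big_ord_recl coefMX /= scale0r add0r.
rewrite (big_morph tau tauD tau0).
by apply: eq_bigr => i _; rewrite coefMX /= tauZ.
Qed.

Lemma carlitzM (a b : A) : carlitz (a * b) = carlitz a \Po carlitz b.
Proof.
elim/poly_ind: a => [|a c IH]; first by rewrite mul0r carlitz0 comp_poly0.
have -> : (a * 'X + c%:P) * b = c *: b + a * b * 'X.
  by rewrite mulrDl mulrAC mul_polyC addrC.
have -> : a * 'X + c%:P = c *: 1 + a * 'X by rewrite addrC alg_polyC.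
rewrite !carlitz_linear carlitz1 !carlitz_mulX IH.
rewrite comp_polyD comp_polyZ comp_polyX; congr (_ + _).
by rewrite /tau comp_polyD comp_polyZ rmorphXn.
Qed.

Let frobXn n (c : nat -> {poly A}) :
  (\sum_(i < n) c i) ^+ #|F| = \sum_(i < n) c i ^+ #|F|.
Proof.
have z : (0 : {poly A}) ^+ #|F| = 0 by rewrite expr0n gtn_eqF.
exact: (big_morph (fun f : {poly A} => f ^+ #|F|) frobA z).
Qed.

Let linD f g : Fq_linear f -> Fq_linear g -> Fq_linear (f + g).
Proof.
move=> lf lg i; rewrite coefD; have [-> | /lf //] := eqVneq f`_i 0.
by rewrite add0r => /lg.
Qed.

Let linZ (c : A) f : Fq_linear f -> Fq_linear (c *: f).
Proof. by move=> lf i; rewrite coefZ mulf_eq0 negb_or => /andP[_ /lf]. Qed.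

Let lin0 : Fq_linear 0.
Proof. by move=> i; rewrite coef0 eqxx. Qed.

Let linXn k : Fq_linear 'X^(#|F| ^ k).
Proof.
move=> i; rewrite coefXn; have [-> _ | _] := eqVneq i (#|F| ^ k)%N.
  by exists k.
by rewrite eqxx.
Qed.

Let lin_sum n (f : nat -> {poly A}) :
  (forall i, Fq_linear (f i)) -> Fq_linear (\sum_(i < n) f i).
Proof. by move=> lf; elim/big_ind: _. Qed.

Let linF f : Fq_linear f -> Fq_linear (f ^+ #|F|).
Proof.
move=> lf; rewrite -[f]coefK poly_def.
rewrite (frobXn _ (fun i => f`_i *: 'X^i)).
apply: (lin_sum _ (f := fun i => (f`_i *: 'X^i) ^+ #|F|)) => i.
have [-> | /lf[k ->]] := eqVneq f`_i 0.
  by rewrite scale0r expr0n gtn_eqF.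
by rewrite exprZn -exprM -expnSr; apply/linZ/linXn.
Qed.

Lemma carlitz_Fq_linear a : Fq_linear (carlitz a).
Proof.
apply: (lin_sum _
  (f := fun i => (a`_i)%:P *: iter i (fun f => carlitzT \Po f) 'X)) => i.
apply: linZ; elim: i => /= [|i IH].
  by have := @linXn 0; rewrite expn0 expr1.
by rewrite carlitzT_comp; apply: linD; [apply: linZ | apply: linF].
Qed.

Lemma carlitz_is_carlitz_module : is_carlitz_module carlitz.
Proof.
split; [exact: carlitz_Fq_linear | exact: carlitz_linear | exact: carlitz1
       | exact: carlitzM | exact: carlitzX].
Qed.

Lemma carlitz_module_unique C : is_carlitz_module C -> C =1 carlitz.
Proof.
case=> _ Cl C1 CM CX; elim/poly_ind => [|a c IH].
  have := Cl (-1) 1 1; rewrite scaleN1r addNr => ->.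
  by rewrite carlitz0 polyCN scaleN1r addNr.
rewrite addrC -alg_polyC Cl carlitz_linear C1 carlitz1; congr (_ + _).
by rewrite mulrC CM carlitzM CX carlitzX IH.
Qed.

End Carlitz.

(* Main.v *)
(* If P and Q = P + 1 are both irreducible then Q divides C_P(1): over
   K = F[T]/Q, with t the class of T, one has Q = prod_i (X - t^(q^i)) and C_Q
   acts as this product evaluated at the operator y |-> t y + y^q, which turns
   out to be y |-> y^(q^deg Q) = y; so C_P = C_Q - C_1 vanishes on K.  As
   C_P(1) has degree q^(deg P - 1) > deg Q, it is composite.  Infinitely many
   such twins come from one pair f, f + 1 by substituting T^(l^k) for T: if a root of f has
   order divisible by the full l-part of q^(deg f) - 1, lifting the exponent
   shows that f(T^(l^k)) stays irreducible.  For q > 3 take linear f and a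
   prime l dividing q - 1; for q = 3 take f = T^3 - T + 1, f + 1 = T^3 - T - 1
   and l = 13. *)
Require Import Defs.
From HB Require Import structures.
From mathcomp Require Import all_boot all_order all_algebra all_field.
From mathcomp Require Import zify.
From mathcomp Require Import boolp classical_sets functions cardinality.

Set Implicit Arguments.
Unset Strict Implicit.
Unset Printing Implicit Defensive.

Import GRing.Theory.
Local Open Scope classical_set_scope.
Local Open Scope ring_scope.

(** * Lifting the exponent: the power of a prime l in (a+1)^n - 1 *)

Lemma expnS_binomial2 a i :
  exists c, (a.+1 ^ i = 1 + i * a + c * a ^ 2)%N.
Proof.
elim: i => [|i [c IH]]; first by exists 0%N.
by exists (i + c * a.+1)%N; rewrite expnSr IH; lia.
Qed.

Lemma sum_expnS a n :
  exists c, (\sum_(i < n) a.+1 ^ i = n + 'C(n, 2) * a + c * a ^ 2)%N.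
Proof.
elim: n => [|n [c IH]]; first by exists 0%N; rewrite big_ord0.
have [c' E] := expnS_binomial2 a n.
exists (c + c')%N; rewrite big_ord_recr /= IH E binS bin1 !mulnDl.
lia.
Qed.

Section LiftingTheExponent.
Variables (l a : nat).
Hypotheses (l_pr : prime l) (l_a : (l %| a)%N).
Hypothesis l2_a : (l ^ 2 %| 'C(l, 2) * a)%N.

(** Both ['C(l, 2) * a] and [a ^ 2] are multiples of l^2, so the sum is l modulo l^2. For l = 2 the
    hypothesis [l2_a] says that 4 divides a. *)
Lemma logn_sum_expnS_prime : logn l (\sum_(i < l) a.+1 ^ i) = 1%N.
Proof.
have [c ->] := sum_expnS a l.
have /dvdnP[u ->] := l2_a; have /dvdnP[v ->] := l_a.
have -> : (l + u * l ^ 2 + c * (v * l) ^ 2 = l * (1 + (u + c * v ^ 2) * l))%N.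
  by rewrite -!mulnn; lia.
rewrite lognM ?(prime_gt0 l_pr) // logn_prime // eqxx lognE l_pr /=.
by rewrite -[X in (_ %| X)%N]addnC dvdn_addr ?dvdn_mull // dvdn1 gtn_eqF ?prime_gt1.
Qed.

Lemma logn_sum_expnS_coprime n :
  coprime l n -> logn l (\sum_(i < n) a.+1 ^ i) = 0%N.
Proof.
move=> co; have [c ->] := sum_expnS a n.
have /dvdnP[v ->] := l_a.
rewrite lognE dvdn_addl; last by rewrite -mulnn !mulnA dvdn_mull.
by rewrite dvdn_addl ?mulnA ?dvdn_mull // -[(l %| n)%N]negbK
  -prime_coprime // co !andbF.
Qed.

End LiftingTheExponent.

(** Split n into a part prime to l, which leaves the valuation unchanged, and a power of l, each
    factor of which raises it by one. *)
Lemma logn_expnS_pred l a n : prime l -> (0 < a)%N -> (l %| a)%N ->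
  (l ^ 2 %| 'C(l, 2) * a)%N -> (0 < n)%N ->
  logn l (a.+1 ^ n).-1 = (logn l a + logn l n)%N.
Proof.
move=> l_pr a_gt0 la l2a n_gt0.
have [[|n'] co {1}->] := pfactor_coprime l_pr n_gt0.
  by move: co; rewrite /coprime gcdn0 => /eqP l1; rewrite l1 in l_pr.
elim: (logn l n) => [|j IH].
  rewrite muln1 predn_exp lognM //; last by rewrite big_ord_recl.
  by rewrite (logn_sum_expnS_coprime l_pr la).
have E : (a.+1 ^ (n'.+1 * l ^ j) = (a.+1 ^ (n'.+1 * l ^ j)).-1.+1)%N.
  by rewrite prednK // expn_gt0.
rewrite expnSr mulnA expnM.
move: IH E; set b := (_ ^ (n'.+1 * _)).-1 => IH ->.
(* Since a divides b, both divisibility hypotheses pass from a to b. *)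
have ab : (a %| b)%N by rewrite /b predn_exp dvdn_mulr.
have b_gt0 : (0 < b)%N.
  rewrite /b -ltnS prednK ?expn_gt0 //.
  apply: (@leq_ltn_trans (a.+1 ^ 0)) => //.
  by rewrite ltn_exp2l // muln_gt0 expn_gt0 (prime_gt0 l_pr).
rewrite predn_exp /= lognM // ?IH; last first.
  by rewrite -(prednK (prime_gt0 l_pr)) big_ord_recl.
rewrite logn_sum_expnS_prime ?addnA ?addn1 ?addnS //.
  exact: dvdn_trans ab.
by apply: dvdn_trans l2a _; rewrite dvdn_mul.
Qed.

Lemma expr_coprime_eq1 (R : nzRingType) (z : R) m n : (0 < m)%N ->
  coprime m n -> z ^+ m = 1 -> z ^+ n = 1 -> z = 1.
Proof.
move=> m_gt0 co zm zn.
have [o o_z om] := prim_order_exists m_gt0 zm.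
have := prim_order_dvd o_z n; rewrite zn eqxx => on.
have : (o %| gcdn m n)%N by rewrite dvdn_gcd om.
rewrite (eqP co) dvdn1 => /eqP o1.
by have := prim_expr_order o_z; rewrite o1 expr1.
Qed.

(** * Frobenius powers and the residue fields of F_q[T] *)

Section Frobenius.
Variables (F : finFieldType) (K : fieldType) (iota : {rmorphism F -> K}).
Local Notation q := #|F|.
Local Notation "g ^i" := (map_poly iota g) (at level 2, format "g ^i").

Lemma exprD_card n (x y : K) : (x + y) ^+ (q ^ n) = x ^+ (q ^ n) + y ^+ (q ^ n).
Proof.
have [p p_pr pF] := finPcharP F; apply: exprDn_pchar.
have [m ->] : exists m, q = (p ^ m)%N.
  by eexists; exact: (card_pprimeChar pF).
by rewrite !pnatX (eq_pnat _ (pcharf_eq (rmorph_pchar iota pF))) pnat_id.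
Qed.

Lemma card_gt1 : (1 < q)%N.
Proof. exact: card_finNzRing_gt1. Qed.

Lemma expf_cardX n (c : F) : c ^+ (q ^ n) = c.
Proof. by elim: n => //= n IH; rewrite expnSr exprM IH expf_card. Qed.

Lemma horner_exp_card n (g : {poly F}) z :
  g^i.[z ^+ (q ^ n)] = g^i.[z] ^+ (q ^ n).
Proof.
elim/poly_ind: g => [|g c IH].
  by rewrite rmorph0 !horner0 expr0n gtn_eqF // expn_gt0 (ltnW card_gt1).
rewrite rmorphD rmorphM /= map_polyX map_polyC !hornerE IH exprD_card exprMn.
by rewrite -rmorphXn expf_cardX.
Qed.

Lemma exp_card_inj n : injective (fun x : K => x ^+ (q ^ n)).
Proof.
move=> x y /= E; apply/eqP; rewrite -subr_eq0.
have : (x - y + y) ^+ (q ^ n) = x ^+ (q ^ n) by rewrite subrK.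
rewrite exprD_card -E -[RHS]add0r => /addIr /eqP.
by rewrite expf_eq0 => /andP[].
Qed.

End Frobenius.

(** An interface to F_q[T]/(f): [res_gen] is the class of T, and [root_res] says that the kernel of
    evaluation at it is (f). *)
Record residue_field (F : finFieldType) (f : {poly F}) := ResidueField {
  res_field :> finFieldType;
  res_const : {rmorphism F -> res_field};
  res_gen : res_field;
  card_res : #|res_field| = (#|F| ^ (size f).-1)%N;
  root_res g : root (map_poly res_const g) res_gen = (f %| g);
  res_gen_surj z : exists g, z = (map_poly res_const g).[res_gen] }.

Lemma residue_field_exists (F : finFieldType) (f : {poly F}) :
  f \is monic -> irreducible_poly f -> inhabited (residue_field f).
Proof.
move=> f_mon f_irr; pose mi : monic_irreducible_poly f := (f_irr, f_mon).
pose K : finFieldType := {poly %/ f with mi}.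
pose iota : {rmorphism F -> K} := qpolyC f.
have hornerE g : (map_poly iota g).[in_qpoly f 'X] = in_qpoly f g.
  by have := in_qpoly_comp_horner f g 'X; rewrite comp_polyXr => ->.
split; apply: (@ResidueField F f K iota (in_qpoly f 'X)).
- exact: card_qfpoly.
- move=> g; rewrite rootE hornerE; apply/eqP/idP => [/val_eqP /= | fg].
    by rewrite -Pdiv.IdomainMonic.modpE mk_monicE.
  by apply/val_eqP; rewrite /= -Pdiv.IdomainMonic.modpE mk_monicE.
- move=> z; exists (val z); rewrite hornerE; apply: val_inj.
  by rewrite /= Pdiv.CommonRing.rmodp_small // size_mk_monic.
Qed.

(** Coprimality survives extension of scalars, so an f that does not divide g shares no root with it
    in any K. This allows K to be the residue field of another polynomial. *)
Lemma root_map_coprime (F : fieldType) (K : fieldType) (iota : {rmorphism F -> K})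
    (f g : {poly F}) z : irreducible_poly f -> root (map_poly iota f) z ->
  root (map_poly iota g) z = (f %| g).
Proof.
move=> f_irr fz; apply/idP/idP => [gz | fg].
  apply: contraLR gz => Nfg.
  have co : coprimep (map_poly iota f) (map_poly iota g).
    by rewrite coprimep_map irreducible_poly_coprime.
  by rewrite (coprimep_root co) // -rootE.
by move: fz; rewrite -!dvdp_XsubCl => fz; apply: dvdp_trans fz _; rewrite dvdp_map.
Qed.

(** * Irreducible polynomials over F_q and their conjugate roots *)

Section IrreducibleFactors.
Variables (F : finFieldType) (f : {poly F}).
Hypotheses (f_mon : f \is monic) (f_irr : irreducible_poly f).
Local Notation q := #|F|.
Local Notation d := (size f).-1.

Lemma irredp_degree_gt0 : (0 < d)%N.
Proof. by rewrite -subn1 subn_gt0; case: f_irr. Qed.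

Lemma res_gen_exp_card (K : residue_field f) n :
  (res_gen K ^+ (q ^ n) == res_gen K) = (f %| 'X^(q ^ n) - 'X).
Proof.
by rewrite -(root_res K) rmorphB /= map_polyXn map_polyX rootE !hornerE subr_eq0.
Qed.

Lemma irredp_dvd_genPoly : f %| 'X^(q ^ d) - 'X.
Proof.
have [K] := residue_field_exists f_mon f_irr.
by rewrite -(res_gen_exp_card K) -(card_res K) expf_card.
Qed.

(** If the class of T is fixed by the q^n-power map, so is every element of the residue field, and
    T^(q^n) - T has q^d roots there. *)
Lemma irredp_dvd_genPoly_leq n : (0 < n)%N -> f %| 'X^(q ^ n) - 'X -> (d <= n)%N.
Proof.
move=> n_gt0; have [K] := residue_field_exists f_mon f_irr.
rewrite -(res_gen_exp_card K) => /eqP E.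
pose p : {poly K} := 'X^(q ^ n) - 'X.
have qn_gt1 : (1 < q ^ n)%N by rewrite -{1}(exp1n n) ltn_exp2r // card_gt1.
have sp : size p = (q ^ n).+1.
  by rewrite size_polyDl ?size_polyXn // size_polyN size_polyX ltnS.
have p0 : p != 0 by rewrite -size_poly_eq0 sp.
have := @max_poly_roots _ p (enum K) p0.
rewrite sp -cardE card_res ltnS leq_exp2l ?card_gt1 //; apply; last exact: enum_uniq.
apply/allP => z _; have [g ->] := res_gen_surj z.
by rewrite rootE !hornerE -horner_exp_card E subrr.
Qed.

(** The class of T is then also fixed by the q^r-power map for r = n mod d, and the degree bound
    forces r = 0. *)
Lemma irredp_dvd_genPoly_dvdn n : f %| 'X^(q ^ n) - 'X -> (d %| n)%N.
Proof.
move=> fn; have [K] := residue_field_exists f_mon f_irr.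
have Ed : res_gen K ^+ (q ^ d) = res_gen K.
  by apply/eqP; rewrite res_gen_exp_card irredp_dvd_genPoly.
have Edk k : res_gen K ^+ (q ^ (k * d)) = res_gen K.
  by elim: k => [|k IH]; rewrite ?expr1 // mulSn expnD exprM Ed.
move: fn; rewrite -(res_gen_exp_card K) {1}(divn_eq n d) expnD exprM Edk.
rewrite res_gen_exp_card => /irredp_dvd_genPoly_leq; rewrite /dvdn.
case: (posnP (n %% d)) => // r_gt0 /(_ isT).
by rewrite leqNgt ltn_pmod ?irredp_degree_gt0.
Qed.

Lemma irredp_prod_conjugates (K : residue_field f) :
  map_poly (res_const K) f = \prod_(i < d) ('X - (res_gen K ^+ (q ^ i))%:P).
Proof.
pose rs := [seq res_gen K ^+ (q ^ i) | i <- iota 0 d].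
rewrite [LHS](@all_roots_prod_XsubC _ _ rs).
- rewrite lead_coef_map (monicP f_mon) rmorph1 scale1r big_map.
  by rewrite -{1}[d]subn0 -/(index_iota 0 d) big_mkord.
- by rewrite size_map size_map_poly size_iota prednK // lt0n size_poly_eq0 irredp_neq0.
- apply/allP => _ /mapP[i _ ->]; rewrite rootE horner_exp_card.
  have /eqP -> : root (map_poly (res_const K) f) (res_gen K) by rewrite root_res.
  by rewrite expr0n gtn_eqF // expn_gt0 (ltnW (card_gt1 F)).
rewrite uniq_rootsE map_inj_in_uniq ?iota_uniq // => i j.
rewrite !mem_iota !add0n /=.
wlog ij : i j / (i <= j)%N.
  move=> W id jd E; case: (leqP i j) => [|/ltnW] ij; first exact: W.
  by apply/esym/W.
(* With t the class of T, cancelling the injective q^i-power leaves t^(q^(j-i)) = t, impossible for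
   0 < j - i < d. *)
move=> id jd; rewrite -(subnK ij) expnD exprM => E.
case: (posnP (j - i)) => [/eqP|].
  by rewrite subn_eq0 => ?; apply/eqP; rewrite eqn_leq subnK ?ij.
move=> ji_gt0; have /irredp_dvd_genPoly_leq : f %| 'X^(q ^ (j - i)) - 'X.
  rewrite -(res_gen_exp_card K); apply/eqP.
  exact/esym/(exp_card_inj (res_const K) E).
by move=> /(_ ji_gt0); rewrite leqNgt (leq_ltn_trans (leq_subr _ _) jd).
Qed.

End IrreducibleFactors.

(** * The operator y |-> t y + y^q and polynomials in it *)

Section CarlitzAction.
Variables (F : finFieldType) (K : fieldType) (iota : {rmorphism F -> K}) (t : K).
Local Notation q := #|F|.

Definition carlitz_act (y : K) := t * y + y ^+ q.

(** Coefficients stand to the left of the operator, which need not commute with scalars of K; a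
    factor ['X] therefore moves into the argument and a constant factor comes out in front. *)
Definition carlitz_eval (g : {poly K}) (y : K) :=
  \sum_(i < size g) g`_i * iter i carlitz_act y.

Lemma carlitz_eval_widen n (g : {poly K}) y : (size g <= n)%N ->
  carlitz_eval g y = \sum_(i < n) g`_i * iter i carlitz_act y.
Proof.
pose G i := g`_i * iter i carlitz_act y.
move=> le; rewrite /carlitz_eval [LHS](big_ord_widen n G) //.
rewrite [LHS]big_mkcond; apply: eq_bigr => i _; case: ltnP => // ?.
by rewrite nth_default // mul0r.
Qed.

Lemma carlitz_evalB (g h : {poly K}) y :
  carlitz_eval (g - h) y = carlitz_eval g y - carlitz_eval h y.
Proof.
pose n := maxn (size (g - h)) (maxn (size g) (size h)).
rewrite !(@carlitz_eval_widen n) /n ?leq_max ?leqnn ?orbT // -sumrB.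
by apply: eq_bigr => i _; rewrite coefB mulrBl.
Qed.

Lemma carlitz_evalC c (g : {poly K}) y :
  carlitz_eval (g * c%:P) y = c * carlitz_eval g y.
Proof.
have le : (size (g * c%:P)%R <= size g)%N by rewrite mulrC mul_polyC size_scale_leq.
rewrite (carlitz_eval_widen _ le) mulr_sumr.
by apply: eq_bigr => i _; rewrite coefMC mulrA [c * _]mulrC.
Qed.

Lemma carlitz_evalX (g : {poly K}) y :
  carlitz_eval (g * 'X) y = carlitz_eval g (carlitz_act y).
Proof.
have le : (size (g * 'X)%R <= (size g).+1)%N.
  by have [->|g0] := eqVneq g 0; rewrite ?mul0r ?size_poly0 ?size_mulX.
rewrite (carlitz_eval_widen _ le) big_ord_recl coefMX mul0r add0r.
by apply: eq_bigr => i _; rewrite coefMX /= -iterSr.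
Qed.

(* With coefficients written on the left, the twisted polynomials over K satisfy
   Frob^n (t + Frob) - t^(q^n) Frob^n = Frob^(n+1), hence the nodes t^(q^i). *)
Lemma carlitz_eval_conjugates n y :
  carlitz_eval (\prod_(i < n) ('X - (t ^+ (q ^ i))%:P)) y = y ^+ (q ^ n).
Proof.
elim: n y => [|n IH] y.
  by rewrite big_ord0 /carlitz_eval size_poly1 big_ord1 coef1 mul1r.
rewrite big_ord_recr /= mulrBr carlitz_evalB carlitz_evalX carlitz_evalC !IH.
rewrite (exprD_card iota) exprMn -exprM -expnS. by rewrite addrAC subrr add0r.
Qed.

End CarlitzAction.

(** * The value C_a(1): reduction modulo a prime, and degree *)

Section CarlitzAtOne.
Variable F : finFieldType.
Local Notation q := #|F|.

Lemma carlitz_at1 (a : {poly F}) :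
  (carlitz a).[1] = \sum_(i < size a) a`_i *: iter i (fun y => 'X * y + y ^+ q) 1.
Proof.
rewrite /carlitz horner_sum; apply: eq_bigr => i _.
rewrite hornerZ mul_polyC; congr (_ *: _).
elim: (i : nat) => [|j IH] /=; first by rewrite hornerX.
by rewrite horner_comp IH /carlitzT !hornerE.
Qed.

Lemma carlitz_at1_root (K : fieldType) (iota : {rmorphism F -> K}) t (a : {poly F}) :
  (map_poly iota (carlitz a).[1]).[t] = carlitz_eval F t (map_poly iota a) 1.
Proof.
rewrite carlitz_at1 rmorph_sum horner_sum /carlitz_eval size_map_poly.
apply: eq_bigr => i _; rewrite /= map_polyZ hornerZ coef_map; congr (_ * _).
elim: (i : nat) => [|j IH] /=; first by rewrite rmorph1 hornerE.
by rewrite rmorphD rmorphM rmorphXn /= map_polyX !hornerE IH.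
Qed.

(** C_(f-1)(1) = C_f(1) - 1, and C_f(1) is 1^(q^d) = 1 modulo f, where d = deg f. *)
Lemma irredp_dvd_carlitz_pred (f : {poly F}) : f \is monic -> irreducible_poly f ->
  f %| (carlitz (f - 1)).[1].
Proof.
move=> f_mon f_irr; have [K] := residue_field_exists f_mon f_irr.
have -> : f - 1 = (-1) *: 1 + f by rewrite scaleN1r addrC.
rewrite carlitz_linear carlitz1 -(root_res K) rootE hornerD hornerZ hornerX.
rewrite mulr1 polyCN rmorphD rmorphN /= rmorph1 hornerD carlitz_at1_root.
rewrite irredp_prod_conjugates // (carlitz_eval_conjugates (res_const K)).
by rewrite expr1n hornerN hornerE addNr.
Qed.

(** For q > 2 the term y^q outgrows T y at each iteration, so C_(T^(i+1))(1) has degree q^i. For q =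
    2 the leading terms already cancel at y = T + 1. *)
Lemma size_carlitz_at1 (a : {poly F}) : (2 < q)%N -> (1 < size a)%N ->
  size (carlitz a).[1] = (q ^ (size a).-2).+1.
Proof.
move=> q_gt2 sa; rewrite carlitz_at1.
pose c i := iter i (fun y : {poly F} => 'X * y + y ^+ q) 1.
have sc i : size (c i.+1) = (q ^ i).+1.
  elim: i => [|i IH].
    by rewrite /c /= mulr1 expr1n size_polyDl ?size_polyX ?size_poly1.
  have ci0 : c i.+1 != 0 by rewrite -size_poly_eq0 IH.
  have sX : size (c i.+1 ^+ q) = (q ^ i.+1).+1.
    have := size_exp (c i.+1) q; rewrite IH /= -expnSr => <-.
    by rewrite prednK // lt0n size_poly_eq0 expf_neq0.
  rewrite [c _.+2]/= -/(c i.+1) addrC size_polyDl // sX.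
  rewrite mulrC size_mulX // IH ltnS expnS.
  have : (0 < q ^ i)%N by rewrite expn_gt0 (ltn_trans _ q_gt2).
  by have := leq_mul q_gt2 (leqnn (q ^ i)); lia.
have := sa; case E: (size a) sa => [|[|d]] // _ _ /=.
have ad : a`_d.+1 != 0.
  by have := lead_coef_eq0 a; rewrite lead_coefE E /= => ->; rewrite -size_poly_eq0 E.
rewrite big_ord_recr /= addrC size_polyDl ?size_scale -/(c d.+1) ?sc //.
rewrite ltnS; apply: leq_trans (size_sum _ _ _) _.
apply/bigmax_leqP => i _; apply: leq_trans (size_scale_leq _ _) _.
(* The term i = 0 is the constant 1, outside the formula [sc]. *)
case: i => [[|i] /= lt]; first by rewrite size_poly1 expn_gt0 (ltn_trans _ q_gt2).
rewrite -/(c i.+1) sc.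
by rewrite ltn_exp2l // ltnW.
Qed.

End CarlitzAtOne.

(** * Irreducibility of f(T^(l^k)) *)

Lemma irredp_factor_exists (F : fieldType) (p : {poly F}) : (1 < size p)%N ->
  exists g, [/\ g \is monic, irreducible_poly g & g %| p].
Proof.
have [n] := ubnP (size p); elim: n p => // n IH p; rewrite ltnS => pn p1.
have [p_irr | /not_andP[//|]] := pselect (irreducible_poly p).
  have lp : (lead_coef p)^-1 != 0 by rewrite invr_eq0 lead_coef_eq0 irredp_neq0.
  exists ((lead_coef p)^-1 *: p); split; last by rewrite dvdpZl.
    by rewrite monicE lead_coefZ mulVf // -invr_eq0.
  split=> [|h h1]; first by rewrite size_scale.
  by rewrite dvdpZr // => /(apply_irredp p_irr h1)/eqp_trans; apply;
    rewrite eqp_sym eqp_scale.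
move=> /existsNP[h /not_implyP[h1 /not_implyP[hp /negP nhp]]].
have p0 : p != 0 by rewrite -size_poly_gt0 ltnW.
have h0 : h != 0 by apply: contraNneq p0 => h0; move: hp; rewrite h0 dvd0p.
have hlt : (size h < size p)%N.
  by rewrite ltn_neqAle (dvdp_leq p0 hp) andbT dvdp_size_eqp.
have [|g [g1 g2 gh]] := IH h (leq_trans hlt pn).
  by rewrite ltn_neqAle eq_sym h1 size_poly_gt0.
by exists g; split=> //; apply: dvdp_trans gh hp.
Qed.

Section PowerLift.
Variable F : finFieldType.
Local Notation q := #|F|.

(* The root of f has an order divisible by the full power of l in
   q ^ deg f - 1; the condition on 'C(l, 2) only matters for l = 2. *)
Definition power_liftable l (f : {poly F}) :=
  let N := (q ^ (size f).-1).-1 in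
  [/\ f \is monic, irreducible_poly f, (l ^ 2 %| 'C(l, 2) * N)%N, (l %| N)%N
    & ~~ (f %| 'X) && ~~ (f %| 'X^(N %/ l) - 1)].

(** It is enough that every irreducible factor g of f(T^n), n = l^k, has degree at least d n. A root
    b of g has order dividing q^(deg g) - 1, while the order of b^n, a root of f, contains the full
    power of l in q^d - 1; lifting the exponent makes n divide (deg g)/d. *)
Lemma irredp_comp_polyXn l k f : prime l -> power_liftable l f ->
  irreducible_poly (f \Po 'X^(l ^ k)).
Proof.
move=> l_pr; set n := (l ^ k)%N; set d := (size f).-1.
case=> f_mon f_irr l2 la /andP[fX fe].
set x := (q ^ d)%N in l2 la fe; set a := x.-1 in l2 la fe.
have d_gt0 : (0 < d)%N by apply: irredp_degree_gt0.
have x_gt1 : (1 < x)%N.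
  by apply: leq_trans (card_gt1 F) _; rewrite -{1}(expn1 q) leq_exp2l ?card_gt1.
have xE : x = a.+1 by rewrite /a prednK // ltnW.
have a_gt0 : (0 < a)%N by rewrite -ltnS -xE.
have n_gt0 : (0 < n)%N by rewrite expn_gt0 prime_gt0.
have sp : (size (f \Po 'X^n)).-1 = (d * n)%N.
  by rewrite size_comp_poly size_polyXn.
have p0 : f \Po 'X^n != 0.
  by rewrite -size_poly_eq0; case: size sp (muln_gt0 d n) => //= <-;
    rewrite d_gt0 n_gt0.
have key g : g \is monic -> irreducible_poly g -> g %| f \Po 'X^n ->
    (d * n <= (size g).-1)%N.
  move=> g_mon g_irr gp; have [K] := residue_field_exists g_mon g_irr.
  have [b bE] : exists b, b = res_gen K by eexists.
  have [al alE] : exists al, al = b ^+ n by eexists.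
  have fal : root (map_poly (res_const K) f) al.
    move: gp; rewrite -(root_res K) map_comp_poly map_polyXn !rootE horner_comp.
    by rewrite hornerXn -bE -alE.
  have al_root h := root_map_coprime h f_irr fal.
  have al0 : al != 0.
    by have := al_root 'X; rewrite map_polyX rootE hornerX (negbTE fX) => ->.
  have b0 : b != 0 by apply: contraNneq al0; rewrite alE => ->; rewrite expr0n gtn_eqF.
  have bm : b ^+ (q ^ (size g).-1) = b by rewrite -(card_res K) expf_card.
  (* Being a power of b, [al] is fixed by the q^(deg g)-power map. *)
  have dm : (d %| (size g).-1)%N.
    apply: irredp_dvd_genPoly_dvdn => //; rewrite -al_root.
    rewrite rmorphB /= map_polyXn map_polyX rootE !hornerE.
    by rewrite alE exprAC bm subrr.
  have ala : al ^+ a = 1.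
    have := al_root ('X^x - 'X); rewrite irredp_dvd_genPoly //.
    rewrite rmorphB /= map_polyXn map_polyX rootE !hornerE subr_eq0 xE exprS.
    by rewrite -[eqbRHS]mulr1 (inj_eq (mulfI al0)) => /eqP.
  have [t mE] := dvdnP dm; rewrite mE in bm *.
  have t_gt0 : (0 < t)%N.
    by have := irredp_degree_gt0 g_irr; rewrite mE; case: (t).
  rewrite mulnC leq_mul2r; apply/orP; right; apply: dvdn_leq => //.
  (* If l^k did not divide t, then [al ^+ (a %/ l) = 1] would follow, against [fe]. *)
  rewrite /n pfactor_dvdn //; apply: contraR fe; rewrite -ltnNge => jk.
  rewrite -al_root rmorphB /= map_polyXn rmorph1 rootE !hornerE subr_eq0.
  apply/eqP.
  have xt_gt1 : (1 < x ^ t)%N.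
    by apply: (leq_trans x_gt1); exact: (@leq_pexp2l x 1 t (ltnW x_gt1) t_gt0).
  have bN : b ^+ (x ^ t).-1 = 1.
    by apply: (mulfI b0); rewrite -exprS prednK ?(ltnW xt_gt1) // mulr1 -expnM mulnC.
  have N_gt0 : (0 < (x ^ t).-1)%N by rewrite -subn1 subn_gt0.
  have [M coM NE] := pfactor_coprime l_pr N_gt0.
  have lN : logn l (x ^ t).-1 = (logn l a + logn l t)%N.
    by rewrite xE logn_expnS_pred.
  (* For z = [al ^+ (a %/ l)], both z^l and z^M are 1, where M is the part of x^t - 1 prime to l. *)
  apply: (expr_coprime_eq1 (prime_gt0 l_pr) coM).
    by rewrite -exprM divnK.
  have : ((x ^ t).-1 %| n * (a %/ l * M))%N.
    rewrite NE lN mulnA mulnC dvdn_pmul2r; last by case: (M) NE N_gt0 => // ->.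
    (* The strict inequality [jk] supplies the one factor l missing from [a %/ l]. *)
    rewrite -(dvdn_pmul2r (prime_gt0 l_pr)) -mulnA divnK // -expnSr.
    rewrite -addnS expnD mulnC dvdn_mul ?dvdn_exp2l //.
    exact: pfactor_dvdnn.
  by case/dvdnP=> u uE; rewrite -exprM alE -exprM uE mulnC exprM bN expr1n.
split.
  by rewrite -subn_gt0 subn1 sp muln_gt0 d_gt0.
move=> g g1 gp.
have g0 : g != 0 by apply: contraNneq p0 => g0; move: gp; rewrite g0 dvd0p.
(* A nonconstant divisor g has an irreducible factor h, whose degree is already that of f(T^n). *)
have [|h [h_mon h_irr hg]] := @irredp_factor_exists _ g.
  by rewrite ltn_neqAle eq_sym g1 size_poly_gt0.
rewrite -dvdp_size_eqp // eqn_leq dvdp_leq //=.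
have := key h h_mon h_irr (dvdp_trans hg gp); rewrite -sp => hp.
rewrite -(prednK (_ : 0 < size (f \Po _)))%N ?size_poly_gt0 //.
apply: leq_ltn_trans hp (leq_trans _ (dvdp_leq g0 hg)).
by rewrite prednK // size_poly_gt0 irredp_neq0.
Qed.

End PowerLift.

(** * Twin primes P, P + 1 and their construction *)

(** If 4 does not divide N > 2, the odd part of N exceeds 1 and has a prime factor. The case of
    interest is N = q - 1. *)
Lemma lifting_prime_exists N : (2 < N)%N ->
  exists l, [/\ prime l, l %| N & (l = 2 -> 4 %| N)]%N.
Proof.
move=> N_gt2; have [dvd4 | ndvd4] := boolP (4 %| N)%N.
  by exists 2%N; split=> //; apply: dvdn_trans dvd4.
pose o := (N`_2^')%N.
have o_gt1 : (1 < o)%N.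
  rewrite ltn_neqAle part_gt0 andbT; apply/eqP => /esym o1.
  have := partnC 2%N (ltnW (ltnW N_gt2)); rewrite -/o o1 muln1 p_part => NE.
  move: ndvd4 N_gt2; rewrite -NE.
  by case: (logn 2 N) => [|[|r]] //; rewrite !expnS mulnA dvdn_mulr.
exists (pdiv o); split; first exact: pdiv_prime.
  by apply: dvdn_trans (pdiv_dvd o) (dvdn_part _ _).
move=> p2; have := part_pnat 2%N^' N.
by rewrite -/o p'natE // -p2 pdiv_dvd.
Qed.

Section TwinPrimes.
Variable F : finFieldType.
Hypothesis q_gt2 : (2 < #|F|)%N.
Local Notation q := #|F|.

Lemma carlitz_twin_composite (P : {poly F}) : (2 < size P)%N ->
  P + 1 \is monic -> irreducible_poly (P + 1) ->
  (carlitz P).[1] \isn't a GRing.unit /\ ~ irreducible_poly (carlitz P).[1].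
Proof.
move=> sP Q_mon Q_irr; set M := (carlitz P).[1].
have sM : size M = (q ^ (size P).-2).+1 by rewrite size_carlitz_at1 // ltnW.
have QM : P + 1 %| M by have := irredp_dvd_carlitz_pred Q_mon Q_irr; rewrite addrK.
have sQ : size (P + 1) = size P by rewrite size_polyDl // size_poly1 ltnW.
split.
  by rewrite poly_unitE sM eqSS gtn_eqF // expn_gt0 ltnW // ltnW.
move=> M_irr; have := eqp_size (apply_irredp M_irr _ QM).
rewrite sQ sM => /(_ (negbT (gtn_eqF (ltnW sP)))).
case: (size P) sP => [|[|[|e]]] // _ /= [].
(* With deg P = e + 2, one has q^(e+1) >= 3(e+1) > e + 2. *)
have := leq_mul q_gt2 (ltn_expl e (ltnW q_gt2)).
by rewrite -expnS => le qe; move: le; rewrite -qe; lia.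
Qed.

(** One prime l serves both, so that a single substitution keeps both irreducible. *)
Definition liftable_twins l (f : {poly F}) :=
  prime l /\ power_liftable l f /\ power_liftable l (f + 1).

Lemma liftable_twins_infinite l f : liftable_twins l f ->
  infinite_set [set P : {poly F} |
    [/\ P \is monic, irreducible_poly P, (carlitz P).[1] \isn't a GRing.unit
      & ~ irreducible_poly (carlitz P).[1]]].
Proof.
case=> l_pr [f_lift f1_lift].
(* Starting from exponent 1 gives degree at least 2 even for linear f. *)
pose P k : {poly F} := f \Po 'X^(l ^ k.+1).
have [f_mon f_irr _ _ _] := f_lift; have [f1_mon _ _ _ _] := f1_lift.
have d_gt0 := irredp_degree_gt0 f_irr.
have sP k : (size (P k)).-1 = ((size f).-1 * l ^ k.+1)%N.
  by rewrite size_comp_poly size_polyXn.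
have n_gt0 k : (0 < l ^ k.+1)%N by rewrite expn_gt0 prime_gt0.
have mon_comp k (g : {poly F}) : g \is monic -> g \Po 'X^(l ^ k.+1) \is monic.
  by move=> gm; rewrite monicE lead_coef_comp ?size_polyXn ?ltnS // (monicP gm);
    rewrite (monicP (monicXn _ _)) expr1n mulr1.
have PE k : P k + 1 = (f + 1) \Po 'X^(l ^ k.+1) by rewrite comp_polyD comp_polyC.
have P_inj : injective P.
  move=> i j /(congr1 (fun p : {poly F} => (size p).-1)); rewrite !sP => /eqP.
  by rewrite eqn_pmul2l // eqn_exp2l ?prime_gt1 // eqSS => /eqP.
apply: (@sub_infinite_set _ (range P)); last first.
  apply/infiniteP; have := @inj_card_eq _ _ [set: nat] P (in2W P_inj).
  by rewrite card_eq_le => /andP[].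
move=> _ [k _ <-] /=.
have sP2 : (2 < size (P k))%N.
  suff : (1 < (size (P k)).-1)%N by case: (size _).
  rewrite sP; apply: (leq_trans (prime_gt1 l_pr)).
  by rewrite expnS mulnCA leq_pmulr // muln_gt0 d_gt0 expn_gt0 prime_gt0.
have [|| U I] := @carlitz_twin_composite (P k) sP2.
- by rewrite PE mon_comp.
- by rewrite PE; apply: irredp_comp_polyXn.
by split=> //; [apply: mon_comp | apply: irredp_comp_polyXn].
Qed.

(** T - b is liftable when b is nonzero and not an l-th power, that is, b^e is not 1. The polynomial
    [p] has degree 2e <= l e = q - 1, so some a in F_q is not a root, and then both a and a + 1
    qualify. *)
Lemma liftable_twins_gt3 : (3 < q)%N -> exists l f, liftable_twins l f.
Proof.
move=> q_gt3; set N := q.-1.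
have N_gt2 : (2 < N)%N by rewrite /N; lia.
have qE : q = N.+1 by rewrite /N prednK // ltnW // ltnW.
have [l [l_pr lN l2N]] := lifting_prime_exists N_gt2.
set e := (N %/ l)%N.
have eN : (e * l = N)%N by rewrite divnK.
have e_gt0 : (0 < e)%N by move: N_gt2; rewrite -eN; case: (e).
pose p : {poly F} := ('X^e - 1) * (('X + 1) ^+ e - 1).
have s1 : size ('X^e - 1 : {poly F}) = e.+1 by rewrite size_XnsubC.
have s2 : size (('X + 1) ^+ e - 1 : {poly F}) = e.+1.
  have sX : size ('X + 1 : {poly F}) = 2 by rewrite -[1]opprK -polyCN size_XsubC.
  have sXe : size (('X + 1 : {poly F}) ^+ e) = e.+1.
    have := size_exp ('X + 1 : {poly F}) e; rewrite sX mul1n => sE.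
    by rewrite -[in RHS]sE prednK // size_poly_gt0 expf_neq0 // -size_poly_gt0 sX.
  by rewrite size_polyDl // sXe size_polyN size_poly1.
have p0 : p != 0 by rewrite mulf_neq0 // -size_poly_eq0 ?s1 ?s2.
have [a pa] : exists a, ~~ root p a.
  apply: contrapT => /forallNP all_root.
  have /max_poly_roots/(_ (enum_uniq F)) : all (root p) (enum F).
    by apply/allP => a _; move: (all_root a) => /negP; rewrite negbK.
  move=> /(_ p0); rewrite size_mul -?size_poly_eq0 ?s1 ?s2 // -cardE qE.
  have := leq_mul (leqnn e) (prime_gt1 l_pr); rewrite eN; lia.
(* This makes -1 a root of [p], so a + 1 is nonzero. For l = 2, e is even because 4 divides N; for
   odd l, e and N have the same parity. *)
have sign_e : (-1 : F) ^+ e = 1.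
  have [l_odd | /(prime_oddPn l_pr) l2] := boolP (odd l); last first.
    have : (2 %| e)%N by move: (l2N l2); rewrite -eN l2 (@dvdn_pmul2r 2 2).
    by rewrite dvdn2 -signr_odd => /negbTE ->.
  have N1 : (-1 : F) ^+ N = 1.
    apply: (mulfI (_ : -1 != 0 :> F)); first by rewrite oppr_eq0 oner_eq0.
    by rewrite -exprS -qE expf_card mulr1.
  by move: N1; rewrite -eN -signr_odd oddM l_odd andbT signr_odd.
move: pa; rewrite /p rootM !rootE !hornerE negb_or !subr_eq0 => /andP[ae a1e].
have a0 : a != 0 by apply: contraNneq a1e => ->; rewrite add0r expr1n.
have a10 : a + 1 != 0.
  by apply: contraNneq ae => /eqP; rewrite addr_eq0 => /eqP ->; rewrite sign_e.
have lift (b : F) : b != 0 -> b ^+ e != 1 -> power_liftable l ('X - b%:P).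
  move=> b0 be; rewrite /power_liftable size_XsubC expn1 -/N -/e; split=> //.
  - exact: monicXsubC.
  - exact: irredp_XsubC.
  - have [l_odd | /(prime_oddPn l_pr) l2] := boolP (odd l).
      by rewrite -mulnn dvdn_mul // prime_dvd_bin //; case: (l) l_pr l_odd => [|[|[|]]].
    by rewrite l2 mul1n l2N.
  - by rewrite !dvdp_XsubCl !rootE !hornerE subr_eq0 b0 be.
exists l, ('X - (a + 1)%:P); split=> //; split; first exact: lift.
by rewrite polyCD opprD addrA subrK; apply: lift.
Qed.

(** Here q - 1 = 2 offers only l = 2, and 4 does not divide 2, so cubics replace linear polynomials:
    x^3 = x on F_3 excludes roots, and 3^3 - 1 = 2 * 13. *)
Lemma liftable_twins_eq3 : q = 3%N -> exists l f, liftable_twins l f.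
Proof.
move=> q3; exists 13%N, ('X^3 - 'X + 1); split=> //.
have cube (x : F) : x ^+ 3 = x by rewrite -q3 expf_card.
have two : (1 + 1 : F) = - 1.
  have [p p_pr pF] := finPcharP F.
  have [m qE] : exists m, q = (p ^ m)%N by eexists; exact: (card_pprimeChar pF).
  have p3 : p = 3%N.
    by apply/eqP; rewrite -dvdn_prime2 // -q3 qE; case: m qE => [|m _];
      rewrite ?q3 // expnS dvdn_mulr.
  have := pcharf0 pF; rewrite p3 !mulrS mulr0n addr0 addrA => h3.
  by apply/eqP; rewrite -addr_eq0 h3.
have lift (c : F) : c != 0 -> power_liftable 13 ('X^3 - 'X + c%:P).
  move=> c0.
  have sf : size ('X^3 - 'X + c%:P) = 4.
    rewrite -addrA size_polyDl ?size_polyXn //.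
    by rewrite (leq_ltn_trans (size_polyD _ _)) // size_polyN size_polyX size_polyC c0.
  rewrite /power_liftable sf q3; split=> //.
  - by rewrite monicE lead_coefE sf !coefE /= subr0 addr0.
  - apply: cubic_irreducible; first by rewrite sf.
    by move=> x; rewrite rootE !hornerE cube subrr add0r.
  (* As 26 / 13 = 2, a cubic has too large a degree to divide T or T^2 - 1. *)
  - apply/andP; split; apply/negP => /dvdp_leq.
      by rewrite sf size_polyX -size_poly_eq0 size_polyX => /(_ isT).
    by rewrite sf -size_poly_eq0 size_XnsubC // => /(_ isT).
split; first by apply: lift; rewrite oner_eq0.
by rewrite -addrA -polyCD two; apply: lift; rewrite oppr_eq0 oner_eq0.
Qed.

End TwinPrimes.

Theorem theorem2p8 (F : finFieldType) (q_gt2 : (2 < #|F|)%N) :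
  infinite_set [set P : {poly F} |
    [/\ P \is monic,
        irreducible_poly P,
        (carlitz P).[1] \isn't a GRing.unit
      & ~ irreducible_poly (carlitz P).[1]]].
Proof.
have [l [f lf]] : exists l (f : {poly F}), liftable_twins l f.
  have := q_gt2; rewrite leq_eqVlt => /predU1P[q3 | q_gt3].
    exact: liftable_twins_eq3.
  exact: liftable_twins_gt3.
exact: liftable_twins_infinite lf.
Qed.
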